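(* Let $0<\delta<1$, $c\in\mathbb{R}$ with $c>1$, and let $I\subset\mathbb{Z}^d$ be a frequency set of finite cardinality $T=|I|\ge 2$. Let $\lambda=c(T-1)$ and assume $N_I\le\lambda$. Then, with probability at least $1-\delta$, the random construction (R) described in the context, run with input $I$, $c$ and $n=1$, produces a reconstructing multiple rank-1 lattice $\Lambda(\boldsymbol z_1,M_1,\dots,\boldsymbol z_{\tilde s},M_{\tilde s})$ for $I$ whose number of sampling nodes $M:=|\Lambda(\boldsymbol z_1,M_1,\dots,\boldsymbol z_{\tilde s},M_{\tilde s})|$ satisfies $$M\le 1-\tilde s+\sum_{\ell=1}^{\tilde s}M_\ell\le\left\lceil\left(\frac{c}{c-1}\right)^2\frac{\ln T-\ln\delta}{2}\right\rceil 2c(T-1)<C_{c,\delta}\,T\ln T,$$ where $C_{c,\delta}$ is a constant depending only on $c$ and $\delta$ with $$C_{c,\delta}\le 2c\left(\left(\frac{c}{c-1}\right)^2\frac{1-\log_2\delta}{2}+\log_2 e\right).$$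
   Context: The expansion of a finite nonempty set $I\subset\mathbb{Z}^d$ is $N_I:=\max_{j=1,\dots,d}\{\max_{\boldsymbol k\in I}k_j-\min_{\boldsymbol l\in I}l_j\}$. For $\boldsymbol z\in\mathbb{Z}^d$, $M\in\mathbb{N}$, the rank-1 lattice is $\Lambda(\boldsymbol z,M)=\{\frac{j}{M}\boldsymbol z\bmod\boldsymbol 1: j=0,\dots,M-1\}\subset[0,1)^d$, and a multiple rank-1 lattice is $\Lambda(\boldsymbol z_1,M_1,\dots,\boldsymbol z_s,M_s)=\bigcup_{\ell=1}^s\Lambda(\boldsymbol z_\ell,M_\ell)$. It is called reconstructing for $I$ if the matrix $(e^{2\pi i\boldsymbol k\cdot\boldsymbol x})$ with rows indexed by the nodes $\boldsymbol x$ of the multiple rank-1 lattice and columns indexed by $\boldsymbol k\in I$ has full column rank. $I_{\bmod M}:=\{\boldsymbol k\bmod M:\boldsymbol k\in I\}$ (componentwise residues in $\{0,\dots,M-1\}$), $P^I:=\{M\in\mathbb{N}: M\text{ prime},\ |I_{\bmod M}|=|I|\}$, and $P^I_{\lambda,n}$ is the set of the $n$ smallest elements of $P^I$ larger than $\lambda$. Construction (R) (input $I$, $c$, $n$): put $\lambda=c(|I|-1)$, $\tilde I=\emptyset$, $\tilde s=0$. While $\tilde I\neq I$: draw a lattice size $M'$ from $P^I_{\lambda,n}$ uniformly at random and $\boldsymbol z'\in[0,M'-1]^d\cap\mathbb{Z}^d$ uniformly at random, all draws being independent; let $J=\{\boldsymbol k\in I:\ \boldsymbol k\cdot\boldsymbol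 z'\not\equiv\boldsymbol h\cdot\boldsymbol z'\ (\mathrm{mod}\ M')\text{ for all }\boldsymbol h\in I\setminus\{\boldsymbol k\}\}$; if $J\not\subset\tilde I$, then increase $\tilde s$ by one, set $M_{\tilde s}=M'$, $\boldsymbol z_{\tilde s}=\boldsymbol z'$ and replace $\tilde I$ by $\tilde I\cup J$; otherwise discard $(\boldsymbol z',M')$. The output is $\Lambda(\boldsymbol z_1,M_1,\dots,\boldsymbol z_{\tilde s},M_{\tilde s})$. *)

(* Defs.v *)
From HB Require Import structures.
From mathcomp Require Import all_boot all_order all_algebra.
From mathcomp Require Import finmap complex.
From mathcomp Require Import all_classical all_reals all_analysis.

Set Implicit Arguments.
Unset Strict Implicit.
Unset Printing Implicit Defensive.

Import Order.TTheory GRing.Theory Num.Theory.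

Local Open Scope classical_set_scope.
Local Open Scope fset_scope.
Local Open Scope ring_scope.

Definition dot (A : pzRingType) (d : nat) (x y : 'rV[A]_d) : A :=
  \sum_(i < d) x 0 i * y 0 i.

(* N_I. The maxima and minima over I start from a coordinate of an arbitrary
   element of I, which leaves their value unchanged as soon as I is nonempty;
   the outer maximum may start from 0 because every spread is nonnegative. *)
Definition max_coord (d : nat) (I : {fset 'rV[int]_d}) (j : 'I_d) : int :=
  \big[Num.max/(head 0 (enum_fset I)) 0 j]_(k <- enum_fset I) k 0 j.

Definition min_coord (d : nat) (I : {fset 'rV[int]_d}) (j : 'I_d) : int :=
  \big[Num.min/(head 0 (enum_fset I)) 0 j]_(l <- enum_fset I) l 0 j.

Definition expansion (d : nat) (I : {fset 'rV[int]_d}) : int :=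
  \big[Num.max/0]_(j < d) (max_coord I j - min_coord I j).

Section Lattices.
Variables (R : realType) (d : nat).

Definition frac_part (x : R) : R := x - (Num.floor x)%:~R.

Definition rank1_lattice (z : 'rV[int]_d) (M : nat) : {fset 'rV[R]_d} :=
  [fset (\row_(i < d) frac_part (j%:R / M%:R * (z 0 i)%:~R)) | j in iota 0 M].

(* A multiple rank-1 lattice is given by its list of pairs (M_l, z_l). *)
Definition multiple_rank1_lattice (L : seq (nat * 'rV[int]_d)) :
    {fset 'rV[R]_d} :=
  \bigcup_(p <- L) rank1_lattice p.2 p.1.

Definition exp2pii (t : R) : R[i] := Complex (cos (2 * pi * t)) (sin (2 * pi * t)).

Definition fourier_matrix (X : {fset 'rV[R]_d}) (I : {fset 'rV[int]_d}) :
    'M[R[i]]_(#|` X|, #|` I|) :=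
  \matrix_(i < #|` X|, j < #|` I|)
    exp2pii (dot (map_mx intr (enum_fset I)`_j) (enum_fset X)`_i).

Definition reconstructing (L : seq (nat * 'rV[int]_d)) (I : {fset 'rV[int]_d}) :
    Prop :=
  \rank (fourier_matrix (multiple_rank1_lattice L) I) = #|` I|.

End Lattices.

Section Construction.
Variables (R : realType) (d : nat) (I : {fset 'rV[int]_d}).

Definition residues (M : nat) : {fset 'rV[int]_d} :=
  [fset (\row_(i < d) modz (k 0 i) M%:Z) | k : 'rV[int]_d in I].

Definition good_prime : pred nat :=
  [pred M | prime M && (#|` residues M| == #|` I|)].

(* The n smallest elements of P^I larger than lam: fewer than n elements of
   P^I that are larger than lam precede M. *)
Definition smallest_good_primes (lam : R) (n : nat) : set nat :=
  [set M | [/\ good_prime M, lam < M%:R &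
    (count (fun q => good_prime q && (lam < q%:R)%R) (iota 0 M) < n)%N]].

Definition box (M : nat) : set 'rV[int]_d :=
  [set z | forall i : 'I_d, 0 <= z 0 i < M%:Z].

(* Meaningful for nonempty finite A only: fset_set A is empty when A is
   infinite, and the mass function is then 0. *)
Definition uniform_mass (T : choiceType) (A : set T) (a : T) : R :=
  \1_A a / #|` fset_set A|%:R.

(* Joint mass function of one draw (M', z'): first M' uniform in the n
   smallest good primes, then, given M', z' uniform in the box. *)
Definition draw_mass (lam : R) (n : nat) (v : nat * 'rV[int]_d) : R :=
  uniform_mass (smallest_good_primes lam n) v.1 * uniform_mass (box v.1) v.2.

Definition unaliased (v : nat * 'rV[int]_d) : {fset 'rV[int]_d} :=
  [fset k in I | all (fun h : 'rV[int]_d =>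
      (dot k v.2 != dot h v.2 %[mod v.1%:Z])%Z) (enum_fset (I `\ k))].

(* A state is the pair of the set of recovered frequencies and the list of the
   retained (M_l, z_l), whose size is the counter s. *)
Definition loop_step (st : {fset 'rV[int]_d} * seq (nat * 'rV[int]_d))
    (v : nat * 'rV[int]_d) :=
  if unaliased v `<=` st.1 then st else (st.1 `|` unaliased v, rcons st.2 v).

(* The state is frozen once every frequency of I is recovered: the loop has
   then stopped and the remaining draws are not used. *)
Fixpoint loop_state (x : nat -> nat * 'rV[int]_d) (t : nat) :
    {fset 'rV[int]_d} * seq (nat * 'rV[int]_d) :=
  if t is t'.+1 then
    let st := loop_state x t' in
    if st.1 == I then st else loop_step st (x t')
  else (fset0, [::]).

(* At most one L satisfies this; none does when the loop never stops. *)
Definition outputs (x : nat -> nat * 'rV[int]_d) (L : seq (nat * 'rV[int]_d)) :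
    Prop :=
  exists t : nat, (loop_state x t).1 = I /\ (loop_state x t).2 = L.

End Construction.

Section Draws.
Variables (R : realType) (disp : measure_display) (Omega : measurableType disp).
Variable P : probability Omega R.

(* Measurability of a map into a countable set with the discrete
   sigma-algebra. *)
Definition discrete_rv (V : Type) (X : Omega -> V) : Prop :=
  forall B : set V, measurable (X @^-1` B).

Definition independent_seq (V : Type) (X : nat -> Omega -> V) : Prop :=
  forall (S : {fset nat}) (B : nat -> set V),
    P (\bigcap_(t in [set` S]) (X t @^-1` B t)) =
    (\prod_(t <- enum_fset S) P (X t @^-1` B t))%E.

Definition construction_draws (d : nat) (I : {fset 'rV[int]_d}) (c : R)
    (n : nat) (X : nat -> Omega -> nat * 'rV[int]_d) : Prop :=
  [/\ forall t, discrete_rv (X t),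
      independent_seq X &
      forall t v,
        P (X t @^-1` [set v]) =
        (draw_mass I (c * (#|` I|%:R - 1)) n v)%:E].

End Draws.

Definition log2 (R : realType) (x : R) : R := ln x / ln 2.

(* Main.v *)
(** Since [N_I <= lam], every prime larger than [lam = c (T - 1)] lies in
    [P^I]; for [n = 1] all draws thus use the smallest prime [M > lam], and
    Bertrand's postulate gives [M <= 2 lam].  For distinct [k, h] in [I], the
    vector [k - h] is nonzero modulo [M], so a uniform [z'] in the box makes
    [k] and [h] collide with probability at most [1/M].  Hence a given [k] is
    missed by one draw with probability at most [(T - 1)/M < 1/c], by [S]
    independent draws with probability at most [c^-S], and some frequency is
    missed with probability at most [T c^-S].  The inequality
    [2 (1 - 1/c)^2 <= ln c] makes this at most [delta] for the number [S] of
    draws in the statement.  On the remaining event the loop stops after at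
    most [S] retained lattices; every [k] in [I] is unaliased on one of them,
    where orthogonality of characters isolates its coefficient, which gives
    full column rank. *)

Require Import Defs.
From HB Require Import structures.
From mathcomp Require Import all_boot all_order all_algebra.
From mathcomp Require Import finmap complex.
From mathcomp Require Import all_classical all_reals all_analysis.
From mathcomp Require Import ring lra zify.

Set Implicit Arguments.
Unset Strict Implicit.
Unset Printing Implicit Defensive.

Import Order.TTheory GRing.Theory Num.Theory.
Import numFieldNormedType.Exports.

(** * Bertrand's postulate *)

(** Distinct primes are coprime, so Gauss's lemma adds them one at a time. *)
Lemma prod_primes_dvdn (a b N : nat) :
  (forall p, a <= p < b -> prime p -> p %| N) ->
  \prod_(a <= p < b | prime p) p %| N.
Proof.
elim: b => [|b IHb] dvdN; first by rewrite big_geq ?dvd1n.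
case: (leqP a b) => [leab|ltba]; last by rewrite big_geq ?dvd1n.
rewrite big_mkcond big_nat_recr //= -big_mkcond /=.
have IH : \prod_(a <= p < b | prime p) p %| N.
  by apply: IHb => p /andP[ap pb]; apply: dvdN; rewrite ap ltnW.
case: ifP => [pr_b|_]; last by rewrite muln1.
rewrite Gauss_dvd ?IH ?dvdN ?leab ?leqnn // coprime_sym.
rewrite big_seq_cond; apply: (big_ind (coprime b)); first exact: coprimen1.
  by move=> x y cx cy; rewrite coprimeMr cx.
move=> p /andP[]; rewrite mem_index_iota => /andP[_ ltpb] pr_p.
by rewrite prime_coprime // dvdn_prime2 // gtn_eqF.
Qed.

Lemma prime_dvd_fact (p n : nat) : prime p -> (p %| n`!) = (p <= n).
Proof.
move=> pr_p; apply/idP/idP => [|lepn]; last by rewrite dvdn_fact ?prime_gt0.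
elim: n => [|n IHn]; first by rewrite fact0 Euclid_dvd1.
rewrite factS Euclid_dvdM // => /orP[/dvdn_leq -> //|/IHn]; exact: leqW.
Qed.

Lemma sum_bin (n : nat) : \sum_(i < n.+1) 'C(n, i) = 2 ^ n.
Proof.
by rewrite -[2]/(1 + 1) expnDn; apply: eq_bigr => i _; rewrite !exp1n !muln1.
Qed.

(** Row [2m+1] of Pascal's triangle has two equal central entries, whose sum is at most
    [2 * 4^m]. *)
Lemma bin_odd_central_le (m : nat) : 'C(m.*2.+1, m) <= 4 ^ m.
Proof.
have: 'C(m.*2.+1, m) + 'C(m.*2.+1, m.+1) <= 2 ^ m.*2.+1.
  rewrite -sum_bin.
  have lt1 : m < m.*2.+2 by lia.
  have lt2 : m.+1 < m.*2.+2 by lia.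
  rewrite (bigD1 (Ordinal lt1)) //= (bigD1 (Ordinal lt2)) /=; last first.
    by rewrite -val_eqE /=; lia.
  by rewrite addnA leq_addr.
rewrite -(@bin_sub _ m.+1) //; last by lia.
rewrite (_ : m.*2.+1 - m.+1 = m); last by lia.
by rewrite expnS -mul2n expnM -[2 ^ 2]/4; lia.
Qed.

(** Strong induction. An even [n > 2] is not prime. For [n = 2m+1], induction covers the primes up
    to [m+1], and the others all divide ['C(2m+1, m)]. *)
Lemma primorial_le (n : nat) : \prod_(0 <= p < n.+1 | prime p) p <= 4 ^ n.
Proof.
elim/ltn_ind: n => n IH.
case: (leqP n 2) => [|lt2n].
  by case: n {IH} => [|[|[|]]] // _; rewrite unlock.
case: (boolP (odd n)) => odd_n; last first.
  rewrite big_mkcond big_nat_recr //= -big_mkcond /=.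
  have -> : prime n = false.
    by apply/negP => /even_prime[] E; move: odd_n lt2n; rewrite E.
  rewrite muln1 -(prednK (ltnW (ltnW lt2n))).
  by apply: leq_trans (IH _ _) _; rewrite ?leq_exp2l //; lia.
have [m def_n] : exists m, n = m.*2.+1.
  by exists n./2; rewrite -[LHS]odd_double_half odd_n.
have m_gt0 : 0 < m by lia.
rewrite (@big_cat_nat _ _ _ m.+2) //=; last by lia.
have -> : 4 ^ n = 4 ^ m.+1 * 4 ^ m by rewrite -expnD; congr (_ ^ _); lia.
apply: leq_mul; first by apply: IH; lia.
apply: leq_trans (bin_odd_central_le m).
apply: dvdn_leq; first by rewrite bin_gt0; lia.
apply: prod_primes_dvdn => p /andP[lemp lepn] pr_p.
have : p %| n`! by rewrite prime_dvd_fact; lia.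
rewrite def_n -(@bin_fact m.*2.+1 m); last by lia.
rewrite !Euclid_dvdM // !prime_dvd_fact //.
by rewrite (_ : m.*2.+1 - m = m.+1); lia.
Qed.

(** From [m] to [m+1] the right side grows by the factor [2(2m+1)/m >= 4]. *)
Lemma bin_central_ge (n : nat) : 0 < n -> 4 ^ n <= n.*2 * 'C(n.*2, n).
Proof.
elim: n => // [] [_ _|n IHn _]; first by [].
have := IHn isT; set m := n.+1 => IH.
have e1 := mul_bin_diag m.*2.+2 m; have e2 := mul_bin_diag m.*2.+1 m.
rewrite /= in e1 e2.
have e3 : 'C(m.*2.+1, m.+1) = 'C(m.*2.+1, m).
  by rewrite -[RHS]bin_sub; [congr 'C(_, _)|]; lia.
rewrite expnS doubleS; rewrite e3 in e2.
have -> : m.*2.+2 * 'C(m.*2.+2, m.+1) = 2 * (m.+1 * 'C(m.*2.+2, m.+1)) by lia.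
rewrite -e1 (_ : m.*2.+2 = 2 * m.+1) ?[2 * (_ * _)]mulnA; last by lia.
rewrite -mulnA -mulnA -e2; nia.
Qed.

(** Legendre's formula for [(2n)!] and [n!], the sum for [n!] being padded with zero terms to a
    common range. The truncated subtraction is exact because [2 floor(x) <= floor(2x)]. *)
Lemma logn_bin_central (p n : nat) : prime p ->
  logn p 'C(n.*2, n) =
  \sum_(1 <= k < n.*2.+1) (n.*2 %/ p ^ k - (n %/ p ^ k).*2).
Proof.
move=> pr_p.
have lefact : n <= n.*2 by lia.
have logn_fact_wide : logn p n`! = \sum_(1 <= k < n.*2.+1) n %/ p ^ k.
  rewrite logn_fact // [RHS](@big_cat_nat _ _ _ n.+1) //= [X in _ + X]big1_seq ?addn0 //.
  move=> k /andP[_]; rewrite mem_index_iota => /andP[ltnk _].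
  by rewrite divn_small // (leq_trans ltnk) // ltnW // ltn_expl // prime_gt1.
have : logn p 'C(n.*2, n) + (logn p n`!).*2 = logn p (n.*2)`!.
  rewrite -(bin_fact lefact) (_ : n.*2 - n = n); last by lia.
  by rewrite !lognM ?muln_gt0 ?fact_gt0 ?bin_gt0 // addnn.
rewrite logn_fact_wide logn_fact // => sumE.
have : \sum_(1 <= k < n.*2.+1) (n.*2 %/ p ^ k - (n %/ p ^ k).*2)
  + (\sum_(1 <= k < n.*2.+1) n %/ p ^ k).*2 = \sum_(1 <= k < n.*2.+1) n.*2 %/ p ^ k.
  rewrite -[X in _ + X]muln2 big_distrl -big_split /=; apply: eq_bigr => k _.
  rewrite muln2 subnK // leq_divRL ?expn_gt0 ?prime_gt0 //.
  by have := leq_divM n (p ^ k); lia.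
lia.
Qed.

(** In [logn_bin_central] each term is at most 1 and those with [p ^ k > 2n] vanish, so the exponent
    is at most [trunc_log p n.*2]. *)
Lemma logn_bin_central_le (p n : nat) : prime p -> 0 < n ->
  p ^ logn p 'C(n.*2, n) <= n.*2.
Proof.
move=> pr_p n_gt0; have p_gt1 := prime_gt1 pr_p.
have n2_gt0 : 0 < n.*2 by lia.
apply: leq_trans (trunc_logP p_gt1 n2_gt0).
rewrite leq_exp2l // logn_bin_central //.
set e := trunc_log p n.*2.
have lt_e : e < n.*2.+1.
  by have := trunc_logP p_gt1 n2_gt0; have := ltn_expl e p_gt1; rewrite -/e; lia.
rewrite (@big_cat_nat _ _ _ e.+1) //= [X in _ + X]big1_seq ?addn0.
  apply: (@leq_trans (\sum_(1 <= k < e.+1) 1)); last first.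
    by rewrite sum_nat_const_nat muln1; lia.
  apply: leq_sum => k _; have pk : 0 < p ^ k by rewrite expn_gt0 ltnW.
  have : n.*2 %/ p ^ k < (n %/ p ^ k).*2.+2 => [|h]; last by lia.
  by rewrite ltn_divLR // -doubleS -doubleMl ltn_double ltn_ceil.
move=> k /andP[_]; rewrite mem_index_iota => /andP[ltek _].
rewrite divn_small ?sub0n //; apply: leq_trans (trunc_log_ltn _ p_gt1) _.
by rewrite leq_exp2l.
Qed.

(** For [2n/3 < p <= n] the term [k = 1] is [2 - 2], and for [k >= 2] already [p ^ k >= 3p > 2n]. *)
Lemma logn_bin_central_eq0 (p n : nat) : prime p -> 2 < p ->
  n.*2 < 3 * p -> p <= n -> logn p 'C(n.*2, n) = 0.
Proof.
move=> pr_p lt2p lt3p lepn; rewrite logn_bin_central // big1_seq // => k /andP[_].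
rewrite mem_index_iota => /andP[k_gt0 _].
case: (ltngtP k 1) k_gt0 => // [lt1k|->] _; last first.
  rewrite expn1 (_ : n.*2 %/ p = 2); last first.
    by apply/eqP; rewrite eqn_leq -ltnS ltn_divLR ?leq_divRL; lia.
  have : 1 <= n %/ p by rewrite leq_divRL ?mul1n; lia.
  by lia.
rewrite divn_small ?sub0n // (leq_trans lt3p) //.
apply: (@leq_trans (p ^ 2)); first by rewrite expnS expn1 leq_mul2r lt2p orbT.
by rewrite leq_exp2l //; lia.
Qed.

Lemma bin_central_factor (n : nat) :
  'C(n.*2, n) = \prod_(0 <= p < n.*2.+1) p ^ logn p 'C(n.*2, n).
Proof.
set N := 'C(n.*2, n).
have N_gt0 : 0 < N by rewrite bin_gt0; lia.
rewrite -[LHS](partnT N_gt0) (@widen_partn (N + n.*2)) ?leq_addr //.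
rewrite (@big_cat_nat _ _ _ n.*2.+1) //=; last by lia.
rewrite [X in _ * X = _]big1_seq ?muln1 //= => p.
rewrite mem_index_iota => /andP[ltnp _].
case: (boolP (prime p)) => pr_p; last by rewrite lognE (negPf pr_p).
rewrite -(@expn0 p); congr (_ ^ _); rewrite logn_bin_central //.
rewrite big1_seq // => k /andP[_]; rewrite mem_index_iota => /andP[k_gt0 _].
rewrite divn_small ?sub0n // (leq_trans ltnp) // -{1}(expn1 p) leq_exp2l //.
exact: prime_gt1.
Qed.

Lemma exists_sqrtn (n : nat) : exists m, m * m <= n < m.+1 * m.+1.
Proof.
elim: n => [|n [m /andP[lem ltm]]]; first by exists 0.
by case: (ltnP n.+1 (m.+1 * m.+1)) => h; [exists m | exists m.+1]; lia.
Qed.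

(* Erdos: each prime up to [m] contributes at most [2n], and a larger one occurs
   at most once and is at most [2n/3]. *)
Lemma bin_central_le_no_prime (n m : nat) : 2 < n -> 1 < m ->
  m * m <= n.*2 < m.+1 * m.+1 ->
  (forall p, prime p -> n < p -> n.*2 < p) ->
  'C(n.*2, n) <= n.*2 ^ m.-1 * 4 ^ (n.*2 %/ 3).
Proof.
move=> n_gt2 m_gt1 /andP[lem ltm] no_prime.
rewrite bin_central_factor (@big_cat_nat _ _ _ m.+1) //=; last by nia.
apply: leq_mul.
  (* The indices 0 and 1 contribute factors 1, which leaves [m - 1] factors, each at most [2n]. *)
  rewrite (@big_cat_nat _ _ _ 2) //=; last by lia.
  rewrite big1_seq ?mul1n; last first.
    move=> p; rewrite mem_index_iota => /andP[_ ltp2].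
    by rewrite lognE; case: p ltp2 => [|[]].
  rewrite -[m.-1]/(m.+1.-2) -subn2 -prod_nat_const_nat; apply: leq_prod => p _.
  case: (boolP (prime p)) => pr_p; last by rewrite lognE (negPf pr_p) expn0; lia.
  by apply: logn_bin_central_le => //; lia.
apply: leq_trans (primorial_le _).
rewrite [leqRHS]big_mkcond /=.
have le3 : (n.*2 %/ 3).+1 <= n.*2.+1 by rewrite ltnS leq_div.
have -> : \prod_(0 <= p < (n.*2 %/ 3).+1) (if prime p then p else 1) =
  \prod_(0 <= p < n.*2.+1) (if prime p && (p < (n.*2 %/ 3).+1) then p else 1).
  rewrite (@big_nat_widen _ _ _ 0 _ n.*2.+1) // [LHS]big_mkcond /=.
  by apply: eq_bigr => p _; case: (prime p); case: (p < _).
rewrite [leqRHS](@big_cat_nat _ _ _ m.+1) //=; last by nia.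
rewrite -[leqLHS]mul1n; apply: leq_mul.
  by apply: prodn_gt0 => p; case: ifP => // /andP[/prime_gt0].
rewrite !big_seq; apply: leq_prod => p; rewrite mem_index_iota => /andP[ltmp lepn].
case: (boolP (prime p)) => pr_p /=; last by rewrite lognE (negPf pr_p) expn0.
have ltpp : n.*2 < p * p by nia.
have lee : p ^ logn p 'C(n.*2, n) <= p.
  rewrite -[leqRHS]expn1 leq_exp2l ?prime_gt1 // leqNgt; apply/negP => lt1.
  have le2 : p ^ 2 <= p ^ logn p 'C(n.*2, n) by rewrite leq_exp2l // prime_gt1.
  have n_gt0 : 0 < n by lia.
  have := leq_trans le2 (logn_bin_central_le pr_p n_gt0).
  by rewrite -mulnn; lia.
case: ifP => // /negbT; rewrite ltnS -ltnNge ltn_divLR // => lt3.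
rewrite logn_bin_central_eq0 //; [by lia | by lia |].
by rewrite leqNgt; apply/negP => /(no_prime _ pr_p); lia.
Qed.

Lemma pow6_lt_exp2 (m : nat) : 30 <= m -> m.+1 ^ 6 < 2 ^ m.
Proof.
elim: m => // m IHm; rewrite leq_eqVlt => /predU1P[<-|lem].
  (* [31 < 2 ^ 5], hence [31 ^ 6 < 2 ^ 30]. *)
  have -> : 30 = 5 * 6 by [].
  by rewrite expnM ltn_exp2r.
have {}IHm : m.+1 ^ 6 < 2 ^ m by apply: IHm; lia.
rewrite [2 ^ _]expnS; apply: leq_ltn_trans (_ : 2 * m.+1 ^ 6 < _); last by lia.
(* The sixth powers grow by a factor of at most [(7/5)^2 = 49/25 < 2] per step. *)
have cube : 5 * m.+2 ^ 3 <= 7 * m.+1 ^ 3.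
  have [b ->] : exists b, m = b + 29 by exists (m - 29); lia.
  by rewrite !expnS !expn0; nia.
rewrite -[6]/(3 * 2) !expnM; move: (m.+2 ^ 3) (m.+1 ^ 3) cube => x y cube.
by rewrite !expnS !expn0 !muln1; nia.
Qed.

(** In the chain 1, 2, 3, 5, 7, 13, ..., 317, 631 each member is at most twice the previous one, so
    the first member above [n] is at most [2n]. *)
Lemma prime_chain (n : nat) : 0 < n < 631 -> exists2 p, prime p & n < p <= n.*2.
Proof.
move=> /andP[n_gt0]; pose good := exists2 p, prime p & n < p <= n.*2.
have step q p : prime p -> p <= q.*2 -> (n < q -> good) -> n < p -> good.
  move=> pr_p lepq IH ltnp; case: (ltnP n q) => [/IH //|leqn].
  by exists p => //; lia.
apply: (step 317 631) => //; apply: (step 163 317) => //.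
apply: (step 83 163) => //; apply: (step 43 83) => //; apply: (step 23 43) => //.
apply: (step 13 23) => //; apply: (step 7 13) => //; apply: (step 5 7) => //.
apply: (step 3 5) => //; apply: (step 2 3) => //; apply: (step 1 2) => //.
by rewrite ltnNge n_gt0.
Qed.

Lemma bertrand (n : nat) : 0 < n -> exists2 p, prime p & n < p <= n.*2.
Proof.
move=> n_gt0; case: (ltnP n 631) => [lt_n|le_n].
  by apply: prime_chain; rewrite n_gt0.
case: (boolP [exists p : 'I_n.*2.+1, prime p && (n < p)]).
  move=> /existsP[p /andP[pr_p ltnp]].
  by exists p; rewrite // ltnp -ltnS ltn_ord.
move=> /existsPn no_prime; exfalso.
have {}no_prime p : prime p -> n < p -> n.*2 < p.
  move=> pr_p ltnp; rewrite ltnNge; apply/negP; rewrite -ltnS => ltp.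
  by have := no_prime (Ordinal ltp); rewrite /= pr_p ltnp.
have [m lt_m] := exists_sqrtn n.*2.
have n_gt2 : 2 < n by lia.
(* [2n >= 1262 > 30 * 30] reaches the threshold of [pow6_lt_exp2]. *)
have m_ge30 : 30 <= m.
  rewrite leqNgt; apply/negP => lt30; have : m.+1 * m.+1 <= 30 * 30 by exact: leq_mul.
  by lia.
have m_gt1 : 1 < m by lia.
have le1 := leq_trans (bin_central_ge n_gt0)
  (leq_mul (leqnn n.*2) (bin_central_le_no_prime n_gt2 m_gt1 lt_m no_prime)).
have {}le1 : 4 ^ n <= n.*2 ^ m * 4 ^ (n.*2 %/ 3).
  by rewrite mulnA -expnS prednK // in le1; lia.
have le3 : (4 ^ (n.*2 %/ 3)) ^ 3 <= 4 ^ n.*2.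
  by rewrite -expnM leq_exp2l // leq_divM.
(* Cubing clears the denominator of [2n/3]: [4 ^ (3n) <= (2n) ^ (3m) * 4 ^ (2n)]. *)
have le2 : 4 ^ n <= (n.*2 ^ m) ^ 3.
  rewrite -(@leq_pmul2r (4 ^ n.*2)) ?expn_gt0 //.
  apply: (@leq_trans ((4 ^ n) ^ 3)); first by rewrite -expnD -expnM leq_exp2l //; lia.
  rewrite -(@leq_exp2r _ _ 3) // expnMn in le1; apply: leq_trans le1 _.
  by rewrite leq_mul2l le3 orbT.
(* [2 ^ (m m) <= 4 ^ n <= (2n) ^ (3m) <= (m+1) ^ (6m)] contradicts [(m+1) ^ 6 < 2 ^ m]. *)
have : (m.+1 ^ 6) ^ m < (m.+1 ^ 6) ^ m; last by rewrite ltnn.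
have m_gt0 : 0 < m by lia.
apply: (@leq_trans ((2 ^ m) ^ m)); first by rewrite ltn_exp2r // pow6_lt_exp2.
have [lem ltm] := andP lt_m.
apply: (@leq_trans (4 ^ n)).
  by rewrite -expnM -[4]/(2 ^ 2) -expnM leq_exp2l // mul2n.
apply: (leq_trans le2); rewrite -expnM.
have -> : (m.+1 ^ 6) ^ m = (m.+1 * m.+1) ^ (m * 3).
  by rewrite -[6]/(2 * 3) expnM mulnn -!expnM; congr (_ ^ _); lia.
by rewrite leq_exp2r ?muln_gt0 ?m_gt0 // ltnW.
Qed.

Local Open Scope classical_set_scope.
Local Open Scope fset_scope.
Local Open Scope ring_scope.

(** * Reconstruction from unaliased frequencies *)

Section ExpTwoPiI.
Variable R : realType.
Implicit Types (s t : R).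

Lemma exp2piiD s t : exp2pii (s + t) = exp2pii s * exp2pii t.
Proof.
rewrite /exp2pii mulrDr cosD sinD; apply/eqP.
by rewrite eq_complex /= eqxx /= addrC.
Qed.

Lemma exp2pii0 : exp2pii 0 = 1 :> R[i].
Proof. by rewrite /exp2pii mulr0 cos0 sin0. Qed.

Lemma exp2pii_nat (n : nat) : exp2pii (n%:R : R) = 1.
Proof.
rewrite /exp2pii -[2 * pi * _]add0r (_ : 2 * pi * _ = pi *+ 2 *+ n).
  by rewrite (periodicn (@cosD2pi R)) (periodicn (@sinD2pi R)) cos0 sin0.
by rewrite mulr_natr mulr_natl.
Qed.

Lemma exp2pii_int (m : int) : exp2pii (m%:~R : R) = 1.
Proof.
case: m => n; first exact: exp2pii_nat.
have := exp2pii0; rewrite -[in exp2pii 0](subrr (n.+1%:R : R)) exp2piiD exp2pii_nat mul1r.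
by rewrite NegzE mulrNz.
Qed.

Lemma exp2pii_natmul t (n : nat) : exp2pii (n%:R * t) = exp2pii t ^+ n.
Proof.
elim: n => [|n IHn]; first by rewrite mul0r exp2pii0.
by rewrite -natr1 mulrDl mul1r exp2piiD IHn exprSr.
Qed.

(** The real part is [1 - 2 sin^2(pi t)], and the sine is positive strictly between 0 and pi. *)
Lemma exp2pii_neq1 t : 0 < t < 1 -> exp2pii t != 1.
Proof.
move=> /andP[t_gt0 t_lt1]; rewrite eq_complex /= negb_and; apply/orP; left.
rewrite -mulrA mulr_natl cos_mulr2n.
have : 0 < sin (pi * t).
  by rewrite sin_gt0_pi // mulr_gt0 ?pi_gt0 //= gtr_pMr ?pi_gt0.
have := sin2cos2 (pi * t); set S := sin _; set K := cos _ => SE S_gt0.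
have : 0 < S ^+ 2 by rewrite exprn_gt0.
by rewrite SE => ?; rewrite lt_eqF //; lra.
Qed.

(** Orthogonality of characters: a geometric sum whose ratio [w] satisfies [w ^ M = 1]. *)
Lemma sum_exp2pii (M : nat) (a : int) : (0 < M)%N ->
  \sum_(j < M) exp2pii (j%:R / M%:R * a%:~R : R) =
  if (M %| a)%Z then M%:R else 0.
Proof.
move=> M_gt0; have M_neq0 : (M%:R : R) != 0 by rewrite pnatr_eq0 -lt0n.
have -> : \sum_(j < M) exp2pii (j%:R / M%:R * a%:~R : R) =
    \sum_(j < M) exp2pii (M%:R^-1 * a%:~R) ^+ j.
  by apply: eq_bigr => j _; rewrite -exp2pii_natmul mulrA.
case: ifPn => [/dvdzP[q ->]|ndvd].
  rewrite -[RHS]mulr1 mulr_natl -[M in RHS]card_ord -sumr_const.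
  apply: eq_bigr => j _; rewrite mulrC intrM -mulrA divff // mulr1.
  by rewrite exp2pii_int expr1n.
set w := exp2pii _.
(* Reducing [a] modulo [M] brings the argument strictly between 0 and 1. *)
have w_neq1 : w - 1 != 0.
  rewrite subr_eq0 /w {1}(divz_eq a M) intrD intrM mulrDr mulrC -mulrA divff //.
  rewrite mulr1 exp2piiD exp2pii_int mul1r.
  have M0 : (M : int) != 0 by rewrite -lt0n.
  rewrite exp2pii_neq1 // mulrC divr_gt0 ?ltr0n //=; last first.
    rewrite ltr0z lt_neqAle modz_ge0 // andbT eq_sym.
    by apply: contra ndvd => /eqP/dvdz_mod0P.
  by rewrite ltr_pdivrMr ?ltr0n // mul1r -[M%:R]/(M%:~R) ltr_int ltz_pmod.
apply: (mulfI w_neq1); rewrite -subrX1 mulr0 /w -exp2pii_natmul mulrA divff //.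
by rewrite mul1r exp2pii_int subrr.
Qed.

End ExpTwoPiI.

Section Reconstruction.
Variables (R : realType) (d : nat).
Implicit Types (L : seq (nat * 'rV[int]_d)) (I : {fset 'rV[int]_d}).

Lemma dotBl (A : pzRingType) (x y z : 'rV[A]_d) : dot (x - y) z = dot x z - dot y z.
Proof. by rewrite /dot -sumrB; apply: eq_bigr => i _; rewrite !mxE mulrBl. Qed.

(* Reducing a node modulo 1 does not change its characters. *)
Lemma exp2pii_dot_frac_part (h z : 'rV[int]_d) (x : R) :
  exp2pii (dot (map_mx intr h) (\row_(i < d) frac_part (x * (z 0 i)%:~R))) =
  exp2pii (x * (dot h z)%:~R).
Proof.
rewrite [dot _ _](_ : _ = x * (dot h z)%:~R +
   (- \sum_(i < d) h 0 i * Num.floor (x * (z 0 i)%:~R))%:~R).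
  by rewrite exp2piiD exp2pii_int mulr1.
rewrite /dot !rmorphN !rmorph_sum /= mulr_sumr -sumrB; apply: eq_bigr => i _.
by rewrite !mxE /frac_part !rmorphM /=; ring.
Qed.

(** A kernel vector [v] gives a trigonometric polynomial vanishing at all nodes. Summing it over a
    lattice where [k] is unaliased, against the conjugate character of [k], leaves [M] times the
    coefficient of [k]. *)
Lemma reconstructing_unaliased L I :
  all (fun p => 0 < p.1)%N L ->
  (forall k, k \in I -> exists2 p, p \in L & k \in unaliased I p) ->
  reconstructing R L I.
Proof.
move=> L_gt0 unal; set X := multiple_rank1_lattice R L.
rewrite /reconstructing -mxrank_tr; apply/eqP; apply: inj_row_free => v v0.
have char_sum0 (x : 'rV[R]_d) : x \in X ->
    \sum_(i < #|` I|) v 0 i * exp2pii (dot (map_mx intr (enum_fset I)`_i) x) = 0.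
  move=> Xx; have ltx : (index x (enum_fset X) < #|` X|)%N by rewrite index_mem.
  have := congr1 (fun u : 'rV__ => u 0 (Ordinal ltx)) v0; rewrite !mxE; apply: etrans.
  by apply: eq_bigr => i _; rewrite !mxE /= nth_index.
apply/rowP => i; rewrite [RHS]mxE.
have Ii : (enum_fset I)`_i \in I by apply: mem_nth.
have [[M z] /= Lp] := unal _ Ii; set k := _`_i in Ii *.
rewrite !inE /= => /andP[_ /allP unal_k].
have M_gt0 : (0 < M)%N := allP L_gt0 _ Lp.
(* The sum is over the index [j] and not over the set of nodes, so orthogonality applies even if
   nodes coincide. *)
have : \sum_(j < M) exp2pii (j%:R / M%:R * (- dot k z)%:~R) *
   (\sum_(l < #|` I|) v 0 l * exp2pii (j%:R / M%:R * (dot (enum_fset I)`_l z)%:~R : R)) = 0.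
  apply: big1 => j _; rewrite -[RHS](mulr0 (exp2pii (j%:R / M%:R * (- dot k z)%:~R))).
  congr (_ * _); pose x : 'rV[R]_d := \row_(i < d) frac_part (j%:R / M%:R * (z 0 i)%:~R).
  apply: etrans (char_sum0 x _).
    by apply: eq_bigr => l _; rewrite exp2pii_dot_frac_part.
  apply/bigfcupP; exists (M, z); rewrite ?Lp //=.
  by apply/imfsetP; exists (j : nat); rewrite //= mem_iota ltn_ord.
under eq_bigr do rewrite mulr_sumr.
rewrite exchange_big /= (bigD1 i) //= -/k [X in _ + X]big1 => [|l ne_li].
  under eq_bigr do rewrite mulrCA -exp2piiD -mulrDr -intrD addNr.
  rewrite -mulr_sumr sum_exp2pii // dvdz0 addr0 => /eqP.
  by rewrite mulf_eq0 pnatr_eq0 -leqn0 leqNgt M_gt0 orbF => /eqP.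
under eq_bigr do rewrite mulrCA -exp2piiD -mulrDr -intrD addrC.
rewrite -mulr_sumr sum_exp2pii // -eqz_mod_dvd eq_sym ifF ?mulr0 //.
apply/negbTE/unal_k; rewrite !inE mem_nth // andbT.
by rewrite nth_uniq // (inj_eq val_inj).
Qed.

End Reconstruction.

(** * Number of nodes of a multiple lattice *)

Section NodeCount.
Variables (R : realType) (d : nat).

Lemma card_rank1_lattice (z : 'rV[int]_d) (M : nat) :
  (#|` rank1_lattice R z M| <= M)%N.
Proof.
apply: leq_trans (leq_imfset_card _ _ _) _; rewrite -[leqRHS](size_iota 0 M).
by rewrite uniq_leq_size ?enum_finmem_uniq // => j; rewrite enum_finmemE.
Qed.

Lemma rank1_lattice0 (z : 'rV[int]_d) (M : nat) : (0 < M)%N -> 0 \in rank1_lattice R z M.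
Proof.
move=> M_gt0; apply/imfsetP; exists 0%N; rewrite /= ?mem_iota //.
by apply/rowP => i; rewrite !mxE !mul0r /frac_part floor0 subr0.
Qed.

(* The union is counted together with the origin, which all lattices share. *)
Lemma card_multiple_rank1_lattice (L : seq (nat * 'rV[int]_d)) :
  all (fun p => 0 < p.1)%N L ->
  #|` multiple_rank1_lattice R L|%:R <= 1 - (size L)%:R + \sum_(p <- L) p.1%:R :> R.
Proof.
move=> L_gt0.
suff: (#|` 0%R |` multiple_rank1_lattice R L| + size L <= 1 + \sum_(p <- L) p.1)%N.
  move=> le; have /leq_trans/(_ le) : (#|` multiple_rank1_lattice R L| + size L <=
      #|` 0%R |` multiple_rank1_lattice R L| + size L)%N.
    by rewrite leq_add2r fsubset_leq_card // fsubsetUr.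
  by rewrite -(ler_nat R) !natrD natr_sum; lra.
rewrite /multiple_rank1_lattice; elim: L L_gt0 => [_|[M z] L IH] /=.
  by rewrite !big_nil fsetU0 cardfs1.
move=> /andP[M_gt0 /IH {}IH]; rewrite !big_cons /=.
set X := \bigcup_(_ <- L) _ in IH *.
(* With the origin set apart, a new lattice adds at most [M - 1] nodes. *)
have := (leq_card_fsetU (rank1_lattice R z M `\ 0) (0 |` X)).1.
have -> : rank1_lattice R z M `\ 0 `|` (0 |` X) = 0 |` (rank1_lattice R z M `|` X).
  by apply/fsetP => x; rewrite !inE; case: (x == 0) => //=; rewrite orbF.
have := cardfsD1 0 (rank1_lattice R z M); rewrite rank1_lattice0 //.
have := card_rank1_lattice z M; rewrite /= add1n.
move: (\sum_(p <- L) _)%N IH => s.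
move: #|` 0 |` X| #|` rank1_lattice R z M| #|` _ `\ 0| #|` 0 |` (_ `|` X)| => a b b' ab.
by lia.
Qed.

End NodeCount.

(** * The sampling loop *)

Section Loop.
Variables (d : nat) (I : {fset 'rV[int]_d}).
Implicit Types (x : nat -> nat * 'rV[int]_d) (t : nat).

Lemma unaliased_sub v : unaliased I v `<=` I.
Proof. by apply/fsubsetP => k; rewrite !inE => /andP[]. Qed.

Lemma loop_state_sub x t : (loop_state I x t).1 `<=` I.
Proof.
elim: t => [|t IH] /=; first exact: fsub0set.
case: ifP => // _; rewrite /loop_step; case: ifP => //= _.
by rewrite fsubUset IH unaliased_sub.
Qed.

Lemma loop_state_unaliased x t k : k \in (loop_state I x t).1 ->
  exists2 p, p \in (loop_state I x t).2 & k \in unaliased I p.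
Proof.
elim: t => //= t IH; case: ifP => // _; rewrite /loop_step; case: ifP => //= _.
rewrite in_fsetU => /orP[/IH[p Lp kp]|kx].
  by exists p; rewrite // mem_rcons inE Lp orbT.
by exists (x t); rewrite // mem_rcons inE eqxx.
Qed.

Lemma loop_state_draws x t p : p \in (loop_state I x t).2 -> exists2 s, (s < t)%N & p = x s.
Proof.
have widen : (exists2 s, (s < t)%N & p = x s) -> exists2 s, (s < t.+1)%N & p = x s.
  by case=> s lts ->; exists s; rewrite // ltnW.
elim: t widen => //= t IH widen.
have {}IH : p \in (loop_state I x t).2 -> exists2 s, (s < t.+1)%N & p = x s.
  move=> Lp; have [|s lts ->] := IH _ Lp; last by exists s; rewrite // ltnW.
  by case=> s lts ->; exists s; rewrite // ltnW.
case: ifP => // _; rewrite /loop_step; case: ifP => //= _.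
by rewrite mem_rcons inE => /orP[/eqP->|//]; exists t.
Qed.

Lemma size_loop_state x t : (size (loop_state I x t).2 <= t)%N.
Proof.
elim: t => //= t IH; case: ifP => _; first exact: leqW.
by rewrite /loop_step; case: ifP => _; rewrite /= ?size_rcons // leqW.
Qed.

(** A discarded draw brings nothing new, and a frozen state is already all of [I], so nothing is
    lost. *)
Lemma unaliased_sub_loop_state x s t : (s < t)%N -> unaliased I (x s) `<=` (loop_state I x t).1.
Proof.
elim: t => //= t IH; rewrite ltnS leq_eqVlt => lest.
case: eqP => [->|_]; first exact: unaliased_sub.
rewrite /loop_step; case/predU1P: lest => [->|/IH le_st]; case: ifP => //= _.
  exact: fsubsetUr.
exact: fsubset_trans le_st (fsubsetUl _ _).
Qed.

Lemma loop_state_done x t :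
  (forall k, k \in I -> exists2 s, (s < t)%N & k \in unaliased I (x s)) ->
  (loop_state I x t).1 = I.
Proof.
move=> unal; apply/eqP; rewrite eqEfsubset loop_state_sub; apply/fsubsetP => k /unal[s lts].
exact/fsubsetP/unaliased_sub_loop_state.
Qed.

End Loop.

(** * Lattice sizes and collisions modulo a prime *)

Section GoodPrimes.
Variables (R : realType) (d : nat) (I : {fset 'rV[int]_d}).

Lemma le_expansion (k h : 'rV[int]_d) (i : 'I_d) :
  k \in I -> h \in I -> k 0 i - h 0 i <= expansion I.
Proof.
move=> kI hI; apply: (@bigmax_sup _ _ _ _ i) => //; apply: lerB.
  exact: (@le_bigmax_seq _ _ _ _ _ k).
exact: (@ge_bigmin_seq _ _ _ _ _ h).
Qed.

(** Each coordinate of [k - h] is a multiple of [M] of absolute value below [M], hence 0. *)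
Lemma eqmod_expansion (M : nat) (k h : 'rV[int]_d) :
  expansion I < M%:Z -> k \in I -> h \in I ->
  (forall i : 'I_d, (M%:Z %| (k 0%R i - h 0%R i)%R)%Z) -> k = h.
Proof.
move=> ltM kI hI kh; apply/rowP => i; apply/eqP; rewrite -subr_eq0.
have := kh i; have := le_expansion i kI hI; have := le_expansion i hI kI.
move: (k 0 i) (h 0 i) (expansion I) ltM => a b e ltM le1 le2 /dvdzP[q def_q].
rewrite def_q mulf_eq0; case: eqVneq => //= q_neq0.
have [q_le|q_ge] : q <= -1 \/ 1 <= q by lia.
  by nia.
by nia.
Qed.

Lemma good_prime_expansion (M : nat) :
  expansion I < M%:Z -> good_prime I M = prime M.
Proof.
move=> ltM; rewrite /good_prime /= andb_idr // => _.
rewrite card_in_imfset //= => k h kI hI /rowP eq_kh.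
apply: (eqmod_expansion ltM) => // i; have := eq_kh i; rewrite !mxE => /eqP.
by rewrite eqz_mod_dvd.
Qed.

Lemma smallest_good_primes1 (lam : R) : 1 <= lam -> (expansion I)%:~R <= lam ->
  exists M, [/\ prime M, lam < M%:R, M%:R <= 2 * lam &
    smallest_good_primes I lam 1 = [set M]].
Proof.
move=> lam_ge1 le_lam.
have good M : lam < M%:R -> good_prime I M = prime M.
  move=> ltM; apply: good_prime_expansion; rewrite -(ltr_int R).
  exact: le_lt_trans le_lam _.
(* Bertrand is applied to the floor of [lam]: an integer above the floor exceeds [lam], and twice
   the floor is at most [2 * lam]. *)
pose n := `|Num.floor lam|%N.
have n_floor : n%:R = (Num.floor lam)%:~R :> R.
  by rewrite -[n%:R]/(n%:Z%:~R) gez0_abs // floor_ge0; lra.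
have le_n : n%:R <= lam by rewrite n_floor floor_le.
have lt_n : lam < n.+1%:R by rewrite -natr1 n_floor; have := floorD1_gt lam; rewrite intrD.
have n_gt0 : (0 < n)%N.
  by rewrite -ltnS -(ltr_nat R); apply: le_lt_trans lt_n.
have [p pr_p /andP[ltnp lep]] := bertrand n_gt0.
have ex : exists M, good_prime I M && (lam < M%:R).
  have ltp : lam < p%:R by apply: lt_le_trans lt_n _; rewrite ler_nat.
  by exists p; rewrite good // pr_p.
have [M /andP[gM ltM] minM] := ex_minnP ex.
have leM : (M <= p)%N.
  apply: minM; have ltp : lam < p%:R by apply: lt_le_trans lt_n _; rewrite ler_nat.
  by rewrite good // pr_p.
exists M; split => //; first by rewrite -good.
  apply: (@le_trans _ _ n.*2%:R); first by rewrite ler_nat (leq_trans leM).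
  by rewrite -mul2n natrM ler_pM2l.
(* A count below 1 means that no good prime above [lam] precedes the chosen one. *)
apply/seteqP; split=> [q [/= gq ltq]|_ ->].
  rewrite ltnS leqNgt -has_count => /hasPn noq.
  apply/eqP; rewrite eqn_leq (minM q) ?gq ?ltq // andbT leqNgt.
  by apply/negP => lt; have := noq M; rewrite mem_iota /= lt gM ltM => /(_ isT).
split=> //=; rewrite ltnS leqNgt -has_count; apply/hasPn => q.
by rewrite mem_iota /= add0n => ltqM; apply/negP => /minM; rewrite leqNgt ltqM.
Qed.

End GoodPrimes.

(** * Zeros of a linear form over a prime field *)

Section CountZeros.
Variables (d p : nat).
Hypothesis pr_p : prime p.

(** Canonical representatives identify the box with a vector space over ['F_p], where collisions
    become zeros of a linear form. *)
Definition lift_row (z : 'rV['F_p]_d) : 'rV[int]_d := \row_i (z 0 i : nat)%:Z.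

Lemma lift_row_inj : injective lift_row.
Proof.
move=> y z /rowP eq_yz; apply/rowP => i; apply/val_inj.
by have := eq_yz i; rewrite !mxE => -[].
Qed.

Lemma range_lift_row : range lift_row = @box d p.
Proof.
apply/seteqP; split=> [_ [z _ <-] i|z boxz].
  by rewrite mxE ltz_nat /= -[ltnRHS](Fp_cast pr_p) ltn_ord.
exists (\row_i (`|z 0%R i|%N%:R : 'F_p)) => //; apply/rowP => i; rewrite !mxE.
have /andP[z_ge0 z_lt] := boxz i.
rewrite /= val_Fp_nat // modn_small; first by rewrite gez0_abs.
by rewrite -ltz_nat gez0_abs.
Qed.

Lemma dot_lift_row (a : 'rV[int]_d) (z : 'rV['F_p]_d) :
  (p %| dot a (lift_row z))%Z = (dot (map_mx intr a) z == 0).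
Proof.
rewrite (dvdz_pcharf (pchar_Fp pr_p)) /dot rmorph_sum /=; congr (_ == _).
apply: eq_bigr => i _; rewrite !mxE rmorphM; congr (_ * _).
exact: (natr_Zp (z 0 i)).
Qed.

(* The zeros of a nonzero linear form can be translated, in a direction where
   the form does not vanish, p times without overlap. *)
Lemma card_dot_eq0 (a : 'rV['F_p]_d) : a != 0 ->
  (#|[set z : 'rV['F_p]_d | dot a z == 0%R]%SET| * p <= #|{: 'rV['F_p]_d}|)%N.
Proof.
case/rV0Pn => i ai; set A := [set _ | _]%SET.
have dot_shift (z : 'rV['F_p]_d) t : dot a (z + t *: delta_mx 0 i) = dot a z + a 0 i * t.
  rewrite /dot (bigD1 i) //= [in RHS](bigD1 i) //= !mxE !eqxx mulr1 mulrDr addrAC.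
  congr (_ + _); congr (_ + _); apply: eq_bigr => j /negbTE ne.
  by rewrite !mxE /= ne mulr0 addr0.
have cardT : #|[set: 'F_p]%SET| = p by rewrite cardsT card_Fp.
rewrite -[X in (_ * X)%N]cardT -cardsX.
(* For [z] in [A], [dot a] takes the value [a 0 i * t] at [f (z, t)], which recovers [t] and then
   [z]. *)
pose f (u : 'rV['F_p]_d * 'F_p) := u.1 + u.2 *: delta_mx 0 i.
rewrite -(@card_in_imset _ _ f) ?max_card // /f.
move=> [y s] [z t]; rewrite !inE /= !andbT => /eqP y0 /eqP z0 eq_yz.
have := dot_shift y s; rewrite eq_yz dot_shift y0 z0 !add0r => /(mulfI ai) ts.
by move: eq_yz; rewrite ts => /addIr ->.
Qed.

End CountZeros.

(** * Numerical estimates *)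

Section RealEstimates.
Variable R : realType.
Implicit Types (c q delta : R) (T : nat).

(* The difference of the two sides is nonincreasing, with derivative
   [- (1 - 2 q)^2 / q]. *)
Lemma sqr_le_oppr_ln q : 0 < q < 1 -> 2 * (1 - q) ^+ 2 <= - ln q.
Proof.
move=> /andP[q_gt0 q_lt1].
pose f (x : R) := - ln x - 2 * (1 - x) ^+ 2.
have f_derive (x : R) : x \in `]q, 1[ -> is_derive x 1 f (- x^-1 + 4 * (1 - x)).
  rewrite in_itv /= => /andP[qx _].
  have x_gt0 : 0 < x by apply: lt_trans qx.
  have dln := is_derive1_ln x_gt0.
  apply: is_derive_eq.
  by rewrite /GRing.scale /=; ring.
have f_cont : {within `[q, 1], continuous f}.
  apply: continuous_in_subspaceT => x; rewrite inE /= in_itv /= => /andP[qx _].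
  have x_gt0 : 0 < x by apply: lt_le_trans qx.
  have dln := is_derive1_ln x_gt0.
  apply: differentiable_continuous; apply/derivable1_diffP.
  by apply: ex_derive.
have [x] := MVT q_lt1 f_derive f_cont.
rewrite in_itv /= => /andP[qx _]; have x_gt0 : 0 < x by apply: lt_trans qx.
have -> : - x^-1 + 4 * (1 - x) = - ((1 - 2 * x) ^+ 2 / x).
  by field; rewrite gt_eqF.
rewrite /f ln1 => fq.
have : 0 <= (1 - 2 * x) ^+ 2 / x * (1 - q).
  by rewrite mulr_ge0 ?divr_ge0 ?sqr_ge0 ?ltW // subr_gt0.
by move: fq; lra.
Qed.

Lemma draw_count_ge0 delta c T : 0 < delta -> delta < 1 -> (0 < T)%N ->
  0 <= (c / (c - 1)) ^+ 2 * ((ln T%:R - ln delta) / 2).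
Proof.
move=> delta_gt0 delta_lt1 T_gt0; rewrite mulr_ge0 ?sqr_ge0 // divr_ge0 // subr_ge0.
rewrite (@le_trans _ _ 0) ?ln_ge0 ?ler1n //.
by rewrite ltW // ln_lt0 // delta_gt0.
Qed.

Lemma ceil_draw_count delta c T : 0 < delta -> delta < 1 -> (0 < T)%N ->
  let A := (c / (c - 1)) ^+ 2 * ((ln T%:R - ln delta) / 2) in
  (Num.ceil A)%:~R = `|Num.ceil A|%N%:R :> R.
Proof.
move=> delta_gt0 delta_lt1 T_gt0 A; rewrite -[RHS]/((absz _ : int)%:~R) gez0_abs //.
by rewrite ceil_ge0 (lt_le_trans _ (draw_count_ge0 _ _ _ _)) // ltrN10.
Qed.

(** After logarithms the claim is [ln T - ln delta <= S * ln c]. The left side is [2 (1 - 1/c)^2 A],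
    because [c / (c - 1)] is the inverse of [1 - 1/c]; then [sqr_le_oppr_ln] and [A <= S] apply. *)
Lemma expr_ceil_le delta c T : 0 < delta -> delta < 1 -> 1 < c -> (0 < T)%N ->
  T%:R * c^-1 ^+ `|Num.ceil ((c / (c - 1)) ^+ 2 * ((ln T%:R - ln delta) / 2))|%N <= delta.
Proof.
move=> delta_gt0 delta_lt1 c_gt1 T_gt0; set A := _ * (_ / 2); set S := absz _.
have A_ge0 : 0 <= A by exact: draw_count_ge0.
have leAS : A <= S%:R by rewrite /S -ceil_draw_count ?ceil_ge.
have c_gt0 : 0 < c by lra.
have q_bounds : 0 < c^-1 < 1 by rewrite invr_gt0 c_gt0 invf_lt1.
have lnc := sqr_le_oppr_ln q_bounds.
have [q_gt0 _] := andP q_bounds.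
rewrite -ler_pdivlMl ?ltr0n //.
rewrite -ler_ln ?posrE ?mulr_gt0 ?exprn_gt0 ?invr_gt0 ?ltr0n //.
rewrite lnXn // lnM ?posrE ?invr_gt0 ?ltr0n //.
rewrite [ln T%:R^-1]lnV ?posrE ?ltr0n //.
have defA : ln T%:R - ln delta = 2 * (1 - c^-1) ^+ 2 * A.
  by rewrite /A; field; lra.
have : 2 * (1 - c^-1) ^+ 2 * A <= - ln c^-1 * S%:R.
  by apply: ler_pM => //; rewrite mulr_ge0 ?sqr_ge0.
by rewrite -[ln _ *+ S]mulr_natr; lra.
Qed.

(** The ceiling is below [A + 1]. Since [T >= 2] gives [ln T / ln 2 >= 1], both the 1 and
    [- ln delta] are absorbed into multiples of [ln T]; replacing [T - 1] by [T] makes the bound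
    strict. *)
Lemma ceil_bound_lt delta c T : 0 < delta -> delta < 1 -> 1 < c -> (2 <= T)%N ->
  (Num.ceil ((c / (c - 1)) ^+ 2 * ((ln T%:R - ln delta) / 2)))%:~R * (2 * c * (T%:R - 1)) <
  2 * c * ((c / (c - 1)) ^+ 2 * ((1 - log2 delta) / 2) + log2 (expR 1)) * T%:R * ln T%:R.
Proof.
move=> delta_gt0 delta_lt1 c_gt1 T_ge2; set K := _ ^+ 2; set A := _ * (_ / 2).
have T_ge2R : 2 <= T%:R :> R by rewrite (ler_nat _ 2).
have lnd : ln delta < 0 by rewrite ln_lt0 // delta_gt0.
have ln2_gt0 : 0 < ln 2 :> R by rewrite ln_gt0 // ltr1n.
have lnT : ln 2 <= ln T%:R :> R by rewrite ler_ln ?posrE // ltr0n; lia.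
have K_ge0 : 0 <= K by rewrite sqr_ge0.
have ratio_ge1 : 1 <= ln T%:R / ln 2 :> R by rewrite ler_pdivlMr // mul1r.
have ltA : (Num.ceil A)%:~R < A + 1 by have := ceilB1_lt A; rewrite intrB; lra.
have A_ge0 : 0 <= A by rewrite mulr_ge0 // divr_ge0 //; lra.
apply: (@le_lt_trans _ _ ((A + 1) * (2 * c * (T%:R - 1)))).
  by apply: ler_wpM2r (ltW ltA); rewrite !mulr_ge0 //; lra.
apply: (@lt_le_trans _ _ ((A + 1) * (2 * c * T%:R))).
  by rewrite ltr_pM2l ?ltr_pM2l; lra.
have -> : 2 * c * (K * ((1 - log2 delta) / 2) + log2 (expR 1)) * T%:R * ln T%:R =
  (K * ((ln T%:R - ln delta * (ln T%:R / ln 2)) / 2) + ln T%:R / ln 2) * (2 * c * T%:R).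
  by rewrite /log2 expRK; field; lra.
rewrite ler_pM2r; last by rewrite !mulr_gt0 //; lra.
apply: lerD => //; rewrite /A ler_wpM2l // ler_pM2r ?invr_gt0 ?ltr0n //.
by rewrite lerB // -[leRHS]mulr1 ler_wnM2l // ltW.
Qed.

End RealEstimates.

(** * Probability of the events of the construction *)

Section Box.
Variables (d p : nat).
Hypothesis pr_p : prime p.

Lemma finite_box : finite_set (@box d p).
Proof. by rewrite -range_lift_row //; apply: finite_image; exact: finite_finset. Qed.

Lemma mem_fset_box z : (z \in fset_set (@box d p)) = (z \in @box d p).
Proof. exact/in_fset_set/finite_box. Qed.

Lemma fset_boxE : fset_set (@box d p) = [fset @lift_row d p z | z in 'rV['F_p]_d].
Proof.
apply/fsetP => z; rewrite mem_fset_box -range_lift_row //.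
apply/idP/imfsetP => [/set_mem[y _ <-]|[y _ ->]]; first by exists y.
by apply/mem_set; exists y.
Qed.

Lemma card_fset_box : #|` fset_set (@box d p)| = #|{: 'rV['F_p]_d}|.
Proof.
by rewrite fset_boxE card_imfset /= -?cardE //; exact: lift_row_inj.
Qed.

Lemma card_box_dot (a : 'rV[int]_d) : (exists i, ~~ (p %| a 0%R i)%Z) ->
  (#|` [fset z in fset_set (@box d p) | (p %| dot a z)%Z]| * p <= #|` fset_set (@box d p)|)%N.
Proof.
move=> [i ai]; rewrite card_fset_box.
have a_neq0 : map_mx intr a != 0 :> 'rV['F_p]_d.
  by apply/rV0Pn; exists i; rewrite mxE -(dvdz_pcharf (pchar_Fp pr_p)).
apply: leq_trans (card_dot_eq0 pr_p a_neq0); rewrite leq_mul2r; apply/orP; right.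
rewrite cardE -(size_map (@lift_row d p)) uniq_leq_size ?fset_uniq // => z.
rewrite !inE fset_boxE => /andP[/imfsetP[y _ ->] ay]; rewrite map_f // mem_enum inE.
by rewrite -dot_lift_row.
Qed.

End Box.

Section Measure.
Context {R : realType} {disp : measure_display} {Omega : measurableType disp}.

(** Union bound for an event that the family only needs to cover. *)
Lemma probability_le_bigsetU (P : probability Omega R) (J : choiceType) (r : seq J)
    (F : J -> set Omega) (A : set Omega) :
  (forall i, i \in r -> measurable (F i)) -> measurable A ->
  (forall w, A w -> exists2 i, i \in r & F i w) ->
  (P A <= \sum_(i <- r) P (F i))%E.
Proof.
move=> mF mA AF; pose U := \big[setU/set0]_(i <- r) F i.
have mU : measurable U.
  by rewrite /U big_seq; apply: bigsetU_measurable => i /mF.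
apply: (@le_trans _ _ (P U)).
  rewrite le_measure ?inE // => w /AF[i ir Fi].
  by rewrite /U -bigcup_seq; exists i.
rewrite /U; elim: r mF {AF U mU} => [|i r IH] mF; first by rewrite !big_nil measure0.
have mFi : measurable (F i) by apply: mF; rewrite mem_head.
have mFr j : j \in r -> measurable (F j) by move=> jr; apply: mF; rewrite inE jr orbT.
rewrite !big_cons; apply: le_trans (measureU2 _ _ _) _ => //.
  by rewrite big_seq; apply: bigsetU_measurable => j /mFr.
by rewrite leeD2l // IH.
Qed.

Lemma prode_le_expr (J : choiceType) (r : seq J) (f : J -> \bar R) (q : R) :
  (forall i, 0 <= f i <= q%:E)%E -> (\prod_(i <- r) f i <= (q ^+ size r)%:E)%E.
Proof.
move=> fq; suff /andP[_ //] : (0 <= \prod_(i <- r) f i <= (q ^+ size r)%:E)%E.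
elim: r => [|i r /andP[IH0 IH]]; first by rewrite big_nil expr0 lexx andbT lee_fin.
have /andP[fi0 fiq] := fq i.
by rewrite big_cons mule_ge0 //= exprS EFinM lee_pmul.
Qed.

(** The preimage is a union over the pairs of values of [X] and [Y], which are countably many. *)
Lemma discrete_rv_comp2 (U V : countType) (W : Type) (X : Omega -> U) (Y : Omega -> V)
    (f : U -> V -> W) :
  discrete_rv X -> discrete_rv Y -> discrete_rv (fun w => f (X w) (Y w)).
Proof.
move=> mX mY B; pose F (u : U * V) :=
  (X @^-1` [set u.1] `&` Y @^-1` [set u.2] `&` [set _ | B (f u.1 u.2)])%classic.
rewrite [_ @^-1` B](_ : _ = \bigcup_u F u)%classic; last first.
  apply/seteqP; split=> [w /= Bw|w [[u v] _ [[/= -> ->]]]//].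
  by exists (X w, Y w).
apply: countable_bigcupT_measurable => [|u]; first exact: countableP.
apply: measurableI; first by apply: measurableI; [exact: mX|exact: mY].
case: (pselect (B (f u.1 u.2))) => Bu.
  by rewrite [X in measurable X](_ : _ = setT) //; apply/seteqP; split.
by rewrite [X in measurable X](_ : _ = set0) //; apply/seteqP; split.
Qed.

Lemma discrete_rv_loop_state (d : nat) (I : {fset 'rV[int]_d})
    (X : nat -> Omega -> nat * 'rV[int]_d) t :
  (forall s, discrete_rv (X s)) -> discrete_rv (fun w => loop_state I (X ^~ w) t).
Proof.
move=> mX; elim: t => [|t IH] /=; last first.
  exact: (discrete_rv_comp2
    (fun st v => if st.1 == I then st else loop_step I st v) IH (mX t)).
move=> B; case: (pselect (B (fset0, [::]))) => B0.
  by rewrite [X in measurable X](_ : _ = setT) //; apply/seteqP; split.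
by rewrite [X in measurable X](_ : _ = set0) //; apply/seteqP; split.
Qed.

End Measure.

(** * Correctness of the output on the favourable event *)

Lemma loop_output_correct (R : realType) (d : nat) (I : {fset 'rV[int]_d})
    (x : nat -> nat * 'rV[int]_d) (S M : nat) (lam : R) :
  (0 < M)%N -> M%:R <= 2 * lam -> I != fset0 -> (forall t, (t < S)%N -> (x t).1 = M) ->
  (forall k, k \in I -> exists2 t, (t < S)%N & k \in unaliased I (x t)) ->
  let L := (loop_state I x S).2 in
  [/\ outputs I x L, reconstructing R L I,
    #|` multiple_rank1_lattice R L|%:R <= 1 - (size L)%:R + \sum_(p <- L) p.1%:R :> R &
    1 - (size L)%:R + \sum_(p <- L) p.1%:R <= S%:R * (2 * lam) :> R].
Proof.
move=> M_gt0 le_M /fset0Pn[k0 k0I] xM unal L.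
have done_S := loop_state_done unal.
have L_M p : p \in L -> p.1 = M by move=> /loop_state_draws[t ltS ->]; apply: xM.
have L_gt0 : all (fun p => 0 < p.1)%N L by apply/allP => p /L_M ->.
have L_unal k : k \in I -> exists2 p, p \in L & k \in unaliased I p.
  by rewrite -{1}done_S; apply: loop_state_unaliased.
split; [by exists S|exact: reconstructing_unaliased|exact: card_multiple_rank1_lattice|].
(* [I] is nonempty, so at least one lattice is retained and [1 - size L <= 0]. *)
have size_ge1 : 1 <= (size L)%:R :> R.
  by rewrite (ler_nat _ 1); have [p] := L_unal _ k0I; case: (L).
have size_le : (size L)%:R <= S%:R :> R by rewrite ler_nat size_loop_state.
have -> : \sum_(p <- L) p.1%:R = (size L)%:R * M%:R :> R.
  rewrite (eq_big_seq (fun=> M%:R)) => [|p /L_M -> //].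
  by rewrite big_const_seq iter_addr_0 count_predT [RHS]mulr_natl.
apply: (@le_trans _ _ ((size L)%:R * M%:R)); first by rewrite gerDr subr_le0.
by apply: ler_pM.
Qed.

(** * Law of one draw and probability of full recovery *)

Section Draws.
Context {R : realType} {disp : measure_display} {Omega : measurableType disp}.
Variables (P : probability Omega R) (d : nat) (I : {fset 'rV[int]_d}) (c : R).
Variables (X : nat -> Omega -> nat * 'rV[int]_d) (M : nat).
Hypothesis draws : construction_draws P I c 1 X.
Hypothesis pr_M : prime M.
Hypothesis M_only : smallest_good_primes I (c * (#|` I|%:R - 1)) 1 = [set M].

Let N : R := #|` fset_set (@box d M)|%:R.

Let N_gt0 : 0 < N.
Proof. by rewrite ltr0n card_fset_box // card_mx expn_gt0 card_Fp // prime_gt0. Qed.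

Lemma draw_mass_box z : z \in fset_set (@box d M) ->
  draw_mass I (c * (#|` I|%:R - 1)) 1 (M, z) = N^-1.
Proof.
rewrite mem_fset_box // => /set_mem boxz.
rewrite /draw_mass /uniform_mass M_only /= fset_set1 cardfs1 divr1.
by rewrite !indicE !mem_set // mul1r mul1r.
Qed.

Lemma prob_draw (B : {fset 'rV[int]_d}) t : B `<=` fset_set (@box d M) ->
  P (X t @^-1` [set v | v.1 = M /\ v.2 \in B]) = (#|` B|%:R / N)%:E.
Proof.
have [mX _ PX] := draws => /fsubsetP sB.
(* The event splits into finitely many disjoint atoms, each of mass [1 / N]. *)
rewrite [X in P X](_ : _ = \big[setU/set0]_(z <- B) (X t @^-1` [set (M, z)])); last first.
  apply/seteqP; split=> [w /= [XM XB]|w].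
    by rewrite -bigcup_seq; exists (X t w).2; rewrite //= -XM -surjective_pairing.
  by rewrite -bigcup_seq => -[z zB /= ->].
rewrite measure_fbigsetU; first last.
- by move=> z z' _ _ [w [/= ->]] [].
- by move=> z _; exact: mX.
rewrite (eq_big_seq (fun=> (N^-1)%:E)) => [|z /sB zbox]; last first.
  by apply: etrans (PX _ _) _; rewrite draw_mass_box.
by rewrite sumEFin big_const_seq iter_addr_0 count_predT mulr_natl.
Qed.

(** The support of the law of a draw; values outside it are possible, but only on a null event. *)
Definition regular_draw (v : nat * 'rV[int]_d) := v.1 = M /\ v.2 \in fset_set (@box d M).

Lemma prob_irregular_draw t : P (X t @^-1` [set v | ~ regular_draw v]) = 0%E.
Proof.
have [mX _ _] := draws.
have -> : X t @^-1` [set v | ~ regular_draw v] = ~` (X t @^-1` [set v | regular_draw v]) by [].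
rewrite probability_setC; last exact: mX.
by rewrite prob_draw // -/N divff ?subee // gt_eqF.
Qed.

Lemma prob_collision t (a : 'rV[int]_d) : (exists i, ~~ (M %| a 0%R i)%Z) ->
  (P (X t @^-1` [set v | v.1 = M /\
      v.2 \in [fset z in fset_set (@box d M) | (M %| dot a z)%Z]]) <= (M%:R^-1)%:E)%E.
Proof.
move=> /(card_box_dot pr_M) cardle; rewrite prob_draw; last first.
  by apply/fsubsetP => z; rewrite !inE => /andP[].
rewrite lee_fin ler_pdivrMr // mulrC ler_pdivlMr ?ltr0n ?prime_gt0 //.
by rewrite -natrM ler_nat.
Qed.

Hypothesis c_gt0 : 0 < c.
Hypothesis le_expansion_lam : (expansion I)%:~R <= c * (#|` I|%:R - 1).
Hypothesis lt_lam_M : c * (#|` I|%:R - 1) < M%:R.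

Lemma prob_aliased t k : k \in I ->
  (P (X t @^-1` [set v | k \notin unaliased I v]) <= (c^-1)%:E)%E.
Proof.
move=> kI; have [mX _ _] := draws.
have ltM : expansion I < M%:Z by rewrite -(ltr_int R); apply: le_lt_trans lt_lam_M.
(* [Some h] is the collision of [k] with [h]; [None] is the null event of an irregular draw. *)
pose F (o : option 'rV[int]_d) := X t @^-1` if o is Some h then
  [set v | v.1 = M /\ v.2 \in [fset z in fset_set (@box d M) | (M %| dot (k - h) z)%Z]]
  else [set v | ~ regular_draw v].
have mF o : measurable (F o) by exact: mX.
apply: (le_trans (probability_le_bigsetU P (r := None :: map some (I `\ k)) (F := F) _ _ _)).
- by move=> o _; exact: mF.
- exact: mX.
- move=> w /= kw; case: (pselect (regular_draw (X t w))) => [[XM Xbox]|Xw]; last first.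
    by exists None; rewrite ?mem_head.
  move: kw; rewrite !inE kI /= => /allPn[h hI /negPn kh].
  exists (Some h); first by rewrite inE map_f.
  split=> //=; rewrite !inE Xbox /= dotBl -eqz_mod_dvd -XM; exact: kh.
rewrite big_cons big_map prob_irregular_draw add0e.
apply: (@le_trans _ _ (\sum_(h <- I `\ k) (M%:R^-1)%:E)).
  rewrite big_seq [leRHS]big_seq; apply: lee_sum => h.
  rewrite !inE => /andP[ne_hk hI]; apply: prob_collision.
  (* If [M] divided every coordinate of [k - h], then [expansion I < M] would force [k = h]. *)
  case: (pselect (exists i, ~~ (M %| (k - h) 0%R i)%Z)) => // noi; case/eqP: ne_hk.
  apply/esym/(eqmod_expansion ltM) => // i; apply/negPn/negP => ni; apply: noi.
  by exists i; rewrite !mxE.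
rewrite sumEFin big_const_seq iter_addr_0 count_predT lee_fin -[leLHS]mulr_natl.
(* The [T - 1] possible collisions total [(T - 1) / M], and [c * (T - 1) < M]. *)
have -> : #|` I `\ k|%:R = #|` I|%:R - 1 :> R.
  by rewrite (cardfsD1 k I) kI natrD addrAC subrr add0r.
rewrite ler_pdivrMr ?ltr0n ?prime_gt0 //.
by rewrite -(ler_pM2l c_gt0) mulrA mulfV ?gt_eqF // mul1r ltW.
Qed.

Lemma prob_all_unaliased (S : nat) (A : set Omega) : measurable A ->
  (forall w, (forall t, (t < S)%N -> regular_draw (X t w)) ->
     (forall k, k \in I -> exists2 t, (t < S)%N & k \in unaliased I (X t w)) -> A w) ->
  ((1 - #|` I|%:R * c^-1 ^+ S)%:E <= P A)%E.
Proof.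
move=> mA sA; have [mX indep _] := draws.
suff : (P (~` A) <= (#|` I|%:R * c^-1 ^+ S)%:E)%E.
  rewrite probability_setC //.
  have [r ->] : exists r, P A = r%:E by exists (fine (P A)); rewrite fineK // fin_num_measure.
  by rewrite -EFinB !lee_fin; lra.
pose times := [fset t in iota 0 S].
have mem_times t : (t \in times) = (t < S)%N by rewrite !inE mem_iota.
have size_times : size times = S.
  rewrite -[RHS](size_iota 0); apply/perm_size/uniq_perm; rewrite ?fset_uniq ?iota_uniq //.
  by move=> t; rewrite mem_times mem_iota.
(* The complement of [A] is covered by irregular draws, indexed by time, and by the events that all
   [S] draws miss a given [k]. *)
pose F (u : nat + 'rV[int]_d) := match u with
  | inl t => X t @^-1` [set v | ~ regular_draw v]
  | inr k => (\bigcap_(t in [set` times]) (X t @^-1` [set v | k \notin unaliased I v]))%classic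
  end.
have mF u : measurable (F u).
  case: u => [t|k]; first exact: mX.
  by apply: fin_bigcap_measurable => [|t _]; [exact: finite_fset|exact: mX].
apply: (le_trans (probability_le_bigsetU P (r := map inl times ++ map inr I) (F := F) _ _ _)).
- by move=> u _; exact: mF.
- exact: measurableC.
- move=> w /= Aw; apply: contrapT => noF; apply: Aw; apply: sA => [t ltS|k kI].
    apply: contrapT => Xt; apply: noF; exists (inl t) => //.
    by rewrite mem_cat map_f ?mem_times.
  apply: contrapT => Xk; apply: noF; exists (inr k).
    by rewrite mem_cat (map_f inr kI) orbT.
  move=> t /=; rewrite mem_times => ltS; apply/negP => kt; apply: Xk.
  by exists t.
rewrite big_cat !big_map /= big1 ?add0e => [|t _]; last exact: prob_irregular_draw.
apply: (@le_trans _ _ (\sum_(k <- I) (c^-1 ^+ S)%:E)%E).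
  rewrite big_seq [leRHS]big_seq; apply: lee_sum => k kI.
  (* Independence turns the intersection over the [S] times into a product of factors at most
     [1/c]. *)
  rewrite indep -[X in _ ^+ X]size_times; apply: prode_le_expr => t.
  by rewrite measure_ge0 prob_aliased.
by rewrite sumEFin big_const_seq iter_addr_0 count_predT lee_fin -[leLHS]mulr_natl.
Qed.

End Draws.

Theorem corollary3p6 (R : realType) (delta c : R)
  (delta_gt0 : 0 < delta) (delta_lt1 : delta < 1) (c_gt1 : 1 < c) :
  exists C : R,
    C <= 2 * c * ((c / (c - 1)) ^+ 2 * ((1 - log2 delta) / 2)
                  + log2 (expR 1)) /\
    forall (d : nat) (I : {fset 'rV[int]_d}),
      (2 <= #|` I|)%N ->
      (expansion I)%:~R <= c * (#|` I|%:R - 1) ->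
      forall (disp : measure_display) (Omega : measurableType disp)
        (P : probability Omega R) (X : nat -> Omega -> nat * 'rV[int]_d),
        construction_draws P I c 1 X ->
        let success := [set w : Omega |
          exists L : seq (nat * 'rV[int]_d),
            [/\ outputs I (X ^~ w) L,
                reconstructing R L I,
                #|` multiple_rank1_lattice R L|%:R <=
                  1 - (size L)%:R + \sum_(p <- L) p.1%:R :> R,
                1 - (size L)%:R + \sum_(p <- L) p.1%:R <=
                  (Num.ceil ((c / (c - 1)) ^+ 2 *
                     ((ln (#|` I|%:R) - ln delta) / 2)))%:~R
                  * (2 * c * (#|` I|%:R - 1)) :> R &
                (Num.ceil ((c / (c - 1)) ^+ 2 *
                   ((ln (#|` I|%:R) - ln delta) / 2)))%:~R
                  * (2 * c * (#|` I|%:R - 1)) <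
                C * #|` I|%:R * ln (#|` I|%:R)]] in
        measurable success /\ ((1 - delta)%:E <= P success)%E.
Proof.
(* The constant is taken equal to the bound allowed for it. *)
exists (2 * c * ((c / (c - 1)) ^+ 2 * ((1 - log2 delta) / 2) + log2 (expR 1))).
split=> // d I I_gt1 le_exp disp Omega P X draws success.
pose lam : R := c * (#|` I|%:R - 1).
have c_gt0 : 0 < c by apply: lt_trans c_gt1.
have card_ge2 : 2 <= #|` I|%:R :> R by rewrite (ler_nat _ 2).
have lam_ge1 : 1 <= lam by rewrite /lam; nra.
have [M [pr_M lt_lam_M le_M M_only]] := smallest_good_primes1 lam_ge1 le_exp.
have C_bound := ceil_bound_lt delta_gt0 delta_lt1 c_gt1 I_gt1.
have S_ceil := ceil_draw_count c delta_gt0 delta_lt1 (ltnW I_gt1).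
have delta_ge := expr_ceil_le delta_gt0 delta_lt1 c_gt1 (ltnW I_gt1).
rewrite /= in S_ceil; set S := absz _ in S_ceil delta_ge.
(* The event is a countable union over [t] of preimages under the discrete loop states. Its last
   inequality, free of [w], is [C_bound]. *)
have m_success : measurable success.
  pose Q L := [/\ reconstructing R L I,
      #|` multiple_rank1_lattice R L|%:R <= 1 - (size L)%:R + \sum_(p <- L) p.1%:R :> R &
      1 - (size L)%:R + \sum_(p <- L) p.1%:R <= S%:R * (2 * c * (#|` I|%:R - 1)) :> R].
  rewrite [success](_ : _ = \bigcup_t ((fun w => loop_state I (X ^~ w) t) @^-1`
      [set st | st.1 = I /\ Q st.2]))%classic; last first.
    apply/seteqP; split=> w; last first.
      move=> [t _ [eqI [rec card bound]]].
      exists (loop_state I (X ^~ w) t).2; split=> //; first by exists t.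
      by rewrite S_ceil.
    move=> [L [[t [eqI eqL]] rec card bound _]].
    by exists t => //=; rewrite eqL; split=> //; split; rewrite // -S_ceil.
  apply: bigcupT_measurable => t; apply: discrete_rv_loop_state.
  by have [] := draws.
split=> //.
apply: (le_trans _ (prob_all_unaliased (S := S) draws pr_M M_only c_gt0
  le_exp lt_lam_M m_success _)).
  by rewrite lee_fin lerB.
move=> w reg unal.
have I_neq0 : I != fset0 by rewrite -cardfs_gt0 ltnW.
have XM t : (t < S)%N -> (X t w).1 = M by move=> /reg[].
have [out rec card bound] := loop_output_correct (prime_gt0 pr_M) le_M I_neq0 XM unal.
exists (loop_state I (X ^~ w) S).2; split=> //.
by rewrite S_ceil -mulrA.
Qed.
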